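(* Let $A$ be a two-sided skew brace. Then $A$ is semiprime if and only if it is strongly semiprime.
   Context: A skew (left) brace is a triple $(A,+,\circ)$ such that $(A,+)$ and $(A,\circ)$ are (not necessarily abelian) groups and $a\circ(b+c)=a\circ b-a+a\circ c$ for all $a,b,c\in A$. The two groups share the same identity element, denoted $0$. It is two-sided if moreover $(a+b)\circ c=a\circ c-c+b\circ c$ for all $a,b,c\in A$. An ideal of $A$ is a subset $I$ that is a normal subgroup of both $(A,+)$ and $(A,\circ)$ and satisfies $-a+a\circ x\in I$ for all $a\in A$, $x\in I$. For $a,b\in A$ put $a*b=-a+a\circ b-b$; for $X,Y\subseteq A$ let $X*Y$ be the subgroup of $(A,+)$ generated by $\{x*y\mid x\in X,y\in Y\}$. A $*$-product of finitely many ideals is any subset obtained from them by applying the operation $(X,Y)\mapsto X*Y$ with an arbitrary bracketing (this operation on subsets need not be associative). $A$ is semiprime if $I*I\neq\{0\}$ for every non-zero ideal $I$ of $A$. $A$ is strongly semiprime if for every non-zero ideal $I$ of $A$, every $*$-product of any (finite, positive) number of copies of $I$, with any bracketing, is non-zero. *)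

(* Defs.v *)
From HB Require Import structures.
From mathcomp Require Import all_boot.
From mathcomp Require Import boolp classical_sets.

Set Implicit Arguments.
Unset Strict Implicit.
Unset Printing Implicit Defensive.

Declare Scope brace_scope.
Delimit Scope brace_scope with B.
Local Open Scope classical_set_scope.
Local Open Scope brace_scope.

(* The groupType structure of A is the circle group; its operation is displayed
   as _ ∘ _ because * denotes a third operation of a skew brace. The additive
   group need not be abelian, so it cannot be a zmodType. *)
Notation "a ∘ b" := (a * b)%g
  (at level 40, left associativity, format "a  ∘  b") : brace_scope.

HB.mixin Record isSkewBrace A of Group A := {
  sbadd : A -> A -> A;
  sbzero : A;
  sbopp : A -> A;
  sbaddA : associative sbadd;
  sbadd0 : left_id sbzero sbadd;
  sbaddr0 : right_id sbzero sbadd;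
  sbaddN : left_inverse sbzero sbopp sbadd;
  sbaddrN : right_inverse sbzero sbopp sbadd;
  sbcircD : forall a b c : A,
    a ∘ sbadd b c = sbadd (sbadd (a ∘ b) (sbopp a)) (a ∘ c)
}.

#[short(type="skewBraceType")]
HB.structure Definition SkewBrace := {A of isSkewBrace A & Group A}.
Bind Scope brace_scope with SkewBrace.sort.

Notation "a + b" := (sbadd a b) : brace_scope.
Notation "- a" := (sbopp a) : brace_scope.
Notation "a - b" := (sbadd a (sbopp b)) : brace_scope.
Notation "0" := (@sbzero _) : brace_scope.

Lemma circ1E (A : skewBraceType) : 1%g = 0 :> A.
Proof.
have := sbcircD (1%g : A) 0 0.
rewrite !mul1g !sbadd0 sbaddr0 => /(congr1 (fun x => x + 1%g)).
by rewrite sbadd0 sbaddN.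
Qed.

Definition additive_group (A : Type) : Type := A.
HB.instance Definition _ (A : skewBraceType) :=
  Choice.copy (additive_group A) A.
HB.instance Definition _ (A : skewBraceType) :=
  @isGroup.Build (additive_group A) (@sbzero A) (@sbopp A) (@sbadd A)
    sbaddA sbadd0 sbaddr0 sbaddN sbaddrN.

Definition subgroup (G : groupType) (H : set G) : Prop :=
  [/\ H 1%g, forall x y, H x -> H y -> H (x * y)%g
    & forall x, H x -> H (x^-1)%g].

Definition normal_subgroup (G : groupType) (H : set G) : Prop :=
  subgroup H /\ forall g x, H x -> H (g * x * g^-1)%g.

Definition two_sided (A : skewBraceType) : Prop :=
  forall a b c : A, (a + b) ∘ c = a ∘ c - c + b ∘ c.

Section SkewBraceDefs.
Variable A : skewBraceType.

Definition ideal (I : set A) : Prop :=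
  [/\ normal_subgroup (I : set (additive_group A)), normal_subgroup I
    & forall a x : A, I x -> I (- a + a ∘ x)].

Definition star (a b : A) : A := - a + a ∘ b - b.

Definition set_star (X Y : set A) : set A :=
  smallest (@subgroup (additive_group A)) [set star x y | x in X & y in Y].

(* star_product s P: P is the value of some bracketing of the *-product of the
   members of s, in that order; there is no empty *-product. *)
Inductive star_product : seq (set A) -> set A -> Prop :=
| star_product1 (X : set A) : star_product [:: X] X
| star_productM (s t : seq (set A)) (X Y : set A) :
    star_product s X -> star_product t Y ->
    star_product (s ++ t) (set_star X Y).

Definition semiprime : Prop :=
  forall I : set A, ideal I -> I <> [set 0] -> set_star I I <> [set 0].

Definition strongly_semiprime : Prop :=
  forall I : set A, ideal I -> I <> [set 0] ->
  forall (n : nat) (P : set A),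
    (0 < n)%N -> star_product (nseq n I) P -> P <> [set 0].

End SkewBraceDefs.

(* Main.v *)
(** The *-product of two ideals of a two-sided skew brace is again an ideal.
    The maps [lam a : b |-> - a + a ∘ b] and, by two-sidedness, the maps
    [rho b : a |-> a ∘ b - b] are additive automorphisms, and so is conjugation
    in the circle group. As [star i j = lam i j - j = - i + rho j i], each of
    them sends a generator [star i j] of [I * J] to another one, and additive
    conjugation is a composite of such maps. Hence the derived series
    [I, I * I, (I * I) * (I * I), ...] of an ideal is a decreasing sequence of
    ideals, nonzero if [A] is semiprime, and each *-product of copies of [I]
    contains one of its terms. *)
Require Import Defs.
From mathcomp Require Import all_boot.
From mathcomp Require Import boolp classical_sets.

Set Implicit Arguments.
Unset Strict Implicit.
Unset Printing Implicit Defensive.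

Local Open Scope classical_set_scope.
Local Open Scope brace_scope.

Section SkewBraceTheory.
Variable A : skewBraceType.
Implicit Types (a b c x y z : A) (I J X Y : set A).

Lemma sbaddKr a b : - a + (a + b) = b.
Proof. by rewrite sbaddA sbaddN sbadd0. Qed.

Lemma sbaddNKr a b : a + (- a + b) = b.
Proof. by rewrite sbaddA sbaddrN sbadd0. Qed.

Lemma sbaddI a b c : a + b = a + c -> b = c.
Proof. by move=> /(congr1 (fun x => - a + x)); rewrite !sbaddKr. Qed.

Lemma sboppK a : - - a = a.
Proof. by apply: (@sbaddI (- a)); rewrite sbaddrN sbaddN. Qed.

Lemma sboppD a b : - (a + b) = - b - a.
Proof. by apply: (@sbaddI (a + b)); rewrite sbaddrN -sbaddA sbaddNKr sbaddrN. Qed.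

Lemma sbopp0 : - 0 = 0 :> A.
Proof. by rewrite -[LHS]sbadd0 sbaddrN. Qed.

Definition sbsimp := (sboppD, sboppK, sbopp0, sbaddKr, sbaddNKr, @sbaddN A,
  @sbaddrN A, @sbadd0 A, @sbaddr0 A).

Definition lam a b : A := - a + a ∘ b.
Definition rho b a : A := a ∘ b - b.
Definition circ_conj b a : A := b ∘ a ∘ (b^-1)%g.

Lemma circE a b : a ∘ b = a + lam a b.
Proof. by rewrite /lam sbaddNKr. Qed.

Lemma lamD a : {morph lam a : b c / b + c}.
Proof. by move=> b c; rewrite /lam sbcircD -!sbaddA. Qed.

Lemma morph_sbadd0 (f : A -> A) : {morph f : x y / x + y} -> f 0 = 0.
Proof.
by move=> fD; apply: (@sbaddI (f 0)); rewrite -fD !sbaddr0.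
Qed.

Lemma morph_sbopp (f : A -> A) :
  {morph f : x y / x + y} -> {morph f : x / - x}.
Proof.
move=> fD x; apply: (@sbaddI (f x)).
by rewrite -fD !sbaddrN morph_sbadd0.
Qed.

Lemma lamM a b c : lam (a ∘ b) c = lam a (lam b c).
Proof.
rewrite [lam b c]/lam lamD (morph_sbopp (lamD a)) /lam mulgA.
by rewrite !sbsimp -?sbaddA !sbsimp.
Qed.

Lemma starE a b : star a b = lam a b - b.
Proof. by []. Qed.

Lemma star_rho a b : star a b = - a + rho b a.
Proof. by rewrite /star /rho sbaddA. Qed.

(** [lam] is an action of the circle group, and [a ∘ x = circ_conj a x ∘ a], so moving [lam a] past
    [lam x] conjugates [x]. *)
Lemma lam_star a x y : lam a (star x y) = star (circ_conj a x) (lam a y).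
Proof.
rewrite !starE lamD (morph_sbopp (lamD a)) -!lamM /circ_conj.
by rewrite mulgVK.
Qed.

Section TwoSided.
Hypothesis hA : two_sided A.

Lemma rhoD b : {morph rho b : x y / x + y}.
Proof. by move=> x y; rewrite /rho hA -!sbaddA. Qed.

Lemma rhoM a b c : rho (b ∘ c) a = rho c (rho b a).
Proof.
rewrite [rho b a]/rho rhoD (morph_sbopp (rhoD c)) /rho mulgA.
by rewrite !sbsimp -?sbaddA !sbsimp.
Qed.

Lemma circ_conjD b : {morph circ_conj b : x y / x + y}.
Proof.
(* Apply [rho (b^-1)] to [b ∘ x = b + lam b x]. Conjugation becomes [lam b], then [rho (b^-1)], then
   an additive conjugation, and all three are additive. *)
have conjE x : circ_conj b x =
    - (b^-1)%g + rho (b^-1)%g (lam b x) + (b^-1)%g.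
  have rhobV : rho (b^-1)%g b = - (b^-1)%g by rewrite /rho mulgV circ1E sbadd0.
  by rewrite -rhobV -rhoD -circE /rho -sbaddA sbaddN sbaddr0.
by move=> x y; rewrite !conjE lamD rhoD -!sbaddA !sbsimp.
Qed.

Lemma circ_conjM a x y : circ_conj a (x ∘ y) = circ_conj a x ∘ circ_conj a y.
Proof. by rewrite /circ_conj !mulgA mulgVK. Qed.

Lemma circ_conj_star a x y :
  circ_conj a (star x y) = star (circ_conj a x) (circ_conj a y).
Proof.
by rewrite /star !circ_conjD !(morph_sbopp (circ_conjD a)) circ_conjM.
Qed.

(** Mirror image of [lam_star]: [rho] is a right action and [y ∘ b = b ∘ (b^-1 ∘ y ∘ b)], so here
    the second argument gets conjugated. *)
Lemma rho_star b x y :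
  rho b (star x y) = star (rho b x) (circ_conj (b^-1)%g y).
Proof.
rewrite !star_rho rhoD (morph_sbopp (rhoD b)) -!rhoM.
by rewrite /circ_conj invgK !mulgA mulgV mul1g.
Qed.

End TwoSided.

(** Convertible to [subgroup] over [additive_group A], but phrased with the brace notations. *)
Definition additive_subgroup X : Prop :=
  [/\ X 0, forall x y, X x -> X y -> X (x + y) & forall x, X x -> X (- x)].

Lemma set_star_subgroup X Y : additive_subgroup (set_star X Y).
Proof.
split=> [S [[]] //|x y xS yS S SP|x xS S SP].
- by case: (SP) => -[_ SD _] _; apply: SD; [apply: xS|apply: yS].
- by case: (SP) => -[_ _ SN] _; apply: SN; apply: xS.
Qed.

Lemma mem_set_star X Y x y : X x -> Y y -> set_star X Y (star x y).
Proof. by move=> xX yY S [_]; apply; exists x => //; exists y. Qed.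

Lemma set_star_min X Y S : additive_subgroup S ->
  (forall x y, X x -> Y y -> S (star x y)) -> set_star X Y `<=` S.
Proof.
move=> hS XYS z; apply; split=> // _ [x xX [y yY <-]]; exact: XYS.
Qed.

Lemma set_starS X X' Y Y' :
  X `<=` X' -> Y `<=` Y' -> set_star X Y `<=` set_star X' Y'.
Proof.
move=> XX' YY'; apply: set_star_min; first exact: set_star_subgroup.
by move=> x y xX yY; apply: mem_set_star; [apply: XX'|apply: YY'].
Qed.

(** The preimage of a subgroup under an additive map is a subgroup, so generators suffice. *)
Lemma set_star_morph X Y (f : A -> A) : {morph f : x y / x + y} ->
  (forall x y, X x -> Y y -> set_star X Y (f (star x y))) ->
  forall z, set_star X Y z -> set_star X Y (f z).
Proof.
move=> fD fXY; have [S0 SD SN] := set_star_subgroup X Y.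
apply: (@set_star_min X Y (f @^-1` set_star X Y)) => //; split.
- by rewrite /preimage /= morph_sbadd0.
- by move=> x y xS yS; rewrite /preimage /= fD; apply: SD.
- by move=> x xS; rewrite /preimage /= (morph_sbopp fD); apply: SN.
Qed.

Section Ideal.
Variable I : set A.
Hypothesis hI : ideal I.

Lemma ideal_subgroup : additive_subgroup I.
Proof. by case: hI => -[[]]. Qed.

Lemma ideal_conj b x : I x -> I (b + x - b).
Proof. by case: hI => -[_ h] _ _; apply: h. Qed.

Lemma ideal_circ_conj b x : I x -> I (circ_conj b x).
Proof. by case: hI => _ [_ h] _; apply: h. Qed.

Lemma ideal_lam a x : I x -> I (lam a x).
Proof. by case: hI => _ _; apply. Qed.

Lemma ideal_rho b x : I x -> I (rho b x).
Proof.
(* Rewrite [x ∘ b] as [b ∘ (b^-1 ∘ x ∘ b)]; this needs only the closure properties of an ideal. *)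
move=> xI; have -> : rho b x = b + lam b (circ_conj (b^-1)%g x) - b.
  by rewrite -circE /circ_conj invgK !mulgA mulgV mul1g.
by apply/ideal_conj/ideal_lam/ideal_circ_conj.
Qed.

Lemma ideal_star_sub : set_star I I `<=` I.
Proof.
have [_ ID IN] := ideal_subgroup.
apply: set_star_min; first exact: ideal_subgroup.
by move=> x y xI yI; rewrite starE; apply: ID; [apply: ideal_lam|apply: IN].
Qed.

End Ideal.

Lemma left_ideal_circ X : additive_subgroup X ->
  (forall a x, X x -> X (lam a x)) -> subgroup X.
Proof.
move=> [X0 XD XN] Xlam; split; first by rewrite circ1E.
- by move=> x y xX yX; rewrite circE; apply: XD => //; apply: Xlam.
(* From [x^-1 ∘ x = 0] one gets [lam (x^-1) x = - x^-1]; then negate. *)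
- move=> x xX; have -> : (x^-1)%g = lam (x^-1)%g (- x) :> A.
    by rewrite (morph_sbopp (lamD _)) /lam mulVg circ1E !sbsimp.
  by apply/Xlam/XN.
Qed.

Lemma set_star_ideal I J :
  two_sided A -> ideal I -> ideal J -> ideal (set_star I J).
Proof.
move=> hA hI hJ; set S := set_star I J.
have hS : additive_subgroup S := set_star_subgroup I J.
have Slam a x : S x -> S (lam a x).
  move: x; apply: set_star_morph; first exact: lamD.
  move=> x y xI yJ; rewrite lam_star.
  by apply: mem_set_star; [apply: ideal_circ_conj|apply: ideal_lam].
have Scirc a x : S x -> S (circ_conj a x).
  move: x; apply: set_star_morph; first exact: circ_conjD.
  move=> x y xI yJ; rewrite circ_conj_star //.
  by apply: mem_set_star; apply: ideal_circ_conj.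
have Srho b x : S x -> S (rho b x).
  move: x; apply: set_star_morph; first exact: rhoD.
  move=> x y xI yJ; rewrite rho_star //.
  by apply: mem_set_star; [apply: ideal_rho|apply: ideal_circ_conj].
have Sconj b x : S x -> S (b + x - b).
  (* With [z = lam (b^-1) x], the right side is [b ∘ z - b = b + lam b z - b], and [lam b z = x]. *)
  move=> xS; have -> : b + x - b = rho b (circ_conj b (lam (b^-1)%g x)).
    by rewrite /rho /circ_conj mulgVK [b ∘ lam _ _]circE -lamM mulgV
       /lam mul1g circ1E !sbsimp.
  by apply: Srho; apply: Scirc; apply: Slam.
by split=> //; split=> //; apply: left_ideal_circ.
Qed.

Definition star_derived I n : set A := iter n (fun X => set_star X X) I.

Lemma star_derived_ideal I n : two_sided A -> ideal I -> ideal (star_derived I n).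
Proof. by move=> hA hI; elim: n => //= n IH; apply: set_star_ideal. Qed.

Lemma star_derivedS I m n : two_sided A -> ideal I -> (m <= n)%N ->
  star_derived I n `<=` star_derived I m.
Proof.
move=> hA hI /subnK <-; elim: (n - m)%N => //= k IH.
by apply: subset_trans IH; apply: ideal_star_sub; apply: star_derived_ideal.
Qed.

(** Induction on the bracketing; the condition on members of [s] passes to both halves of a
    concatenation. *)
Lemma star_product_derived I s P : two_sided A -> ideal I ->
  star_product s P -> {in s, forall X, X = I} ->
  exists n, star_derived I n `<=` P.
Proof.
move=> hA hI; elim=> {s P} [X|s t X Y _ IHs _ IHt] sI.
  by exists 0%N; rewrite /= (sI X) ?mem_head.
have [|m mX] := IHs; first by move=> Z Zs; apply: sI; rewrite mem_cat Zs.
have [|n nY] := IHt; first by move=> Z Zt; apply: sI; rewrite mem_cat Zt orbT.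
(* The series decreases, so both factors contain its term of index [maxn m n]; the product contains
   the square of that term, which is the next one. *)
exists (maxn m n).+1; apply: set_starS.
- by apply: subset_trans mX; apply: star_derivedS => //; apply: leq_maxl.
- by apply: subset_trans nY; apply: star_derivedS => //; apply: leq_maxr.
Qed.

Lemma semiprime_derived I n : two_sided A -> semiprime A -> ideal I ->
  I <> [set 0] -> star_derived I n <> [set 0].
Proof.
move=> hA sA hI I0; elim: n => //= n; apply: sA; exact: star_derived_ideal.
Qed.

End SkewBraceTheory.

Theorem theorem5p5 (A : skewBraceType) (hA : two_sided A) :
  semiprime A <-> strongly_semiprime A.
Proof.
split=> [sA I hI I0 n P _ hP P0|sA I hI I0].
  have [|k kP] := star_product_derived hA hI hP.
    by move=> X; rewrite mem_nseq => /andP[_ /eqP].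
  apply: (semiprime_derived (n := k) hA sA hI I0).
  (* If [P] were zero, the derived term inside it, which contains [0], would be zero too. *)
  have [D0 _ _] := ideal_subgroup (star_derived_ideal k hA hI).
  apply/seteqP; split; first by rewrite -P0.
  by move=> _ ->.
apply: (sA I hI I0 2) => //.
exact: (star_productM (star_product1 I) (star_product1 I)).
Qed.
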